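(* Let $q$ be a prime power, $n,k$ integers with $1<k<n-1$, and $V=\mathbb{F}_q^n$. If $n<(q+1)^2+k-2$, then $d_c(X,Y)=d(X,Y)$ for all $X,Y\in\mathcal{C}(n,k)_q$.
   Context: $\mathbb{F}_q$ is the finite field with $q$ elements. For $i=1,\dots,n$, $C_i=\{(x_1,\dots,x_n)\in V: x_i=0\}$. A non-degenerate linear $[n,k]_q$ code is a $k$-dimensional subspace of $V$ not contained in any $C_i$; $\mathcal{C}(n,k)_q$ is the set of all such codes. The Grassmann graph $\Gamma_k(V)$ has as vertices the $k$-dimensional subspaces of $V$, two adjacent iff their intersection is $(k-1)$-dimensional; its graph distance is $d(X,Y)=k-\dim(X\cap Y)$. $\Gamma(n,k)_q$ is the induced subgraph of $\Gamma_k(V)$ on $\mathcal{C}(n,k)_q$ (it is connected), and $d_c(X,Y)$ denotes the graph distance between $X$ and $Y$ in $\Gamma(n,k)_q$. *)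

(* Defs.v *)
From HB Require Import structures.
From mathcomp Require Import all_boot all_order all_algebra.

Set Implicit Arguments.
Unset Strict Implicit.
Unset Printing Implicit Defensive.

Import GRing.Theory.
Local Open Scope ring_scope.

HB.instance Definition _ (F : finFieldType) (vT : vectType F) :
  isCountable {vspace vT} := CanIsCountable (@VectorInternalTheory.vs2mxK F vT).
HB.instance Definition _ (F : finFieldType) (vT : vectType F) :
  isFinite {vspace vT} := CanIsFinite (@VectorInternalTheory.vs2mxK F vT).

Section Graph.

Variables (T : finType) (e : rel T).

Definition walk_of_length (x y : T) (m : nat) : bool :=
  [exists p : m.-tuple T, path e x p && (last x p == y)].

(* A shortest walk has length < #|T|, so the value #|T| occurs exactly when y
   is not reachable from x; it plays the role of infinity. *)
Definition graph_dist (x y : T) : nat :=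
  find (walk_of_length x y) (iota 0 #|T|).

Definition induced (A : {set T}) : rel T :=
  [rel x y | [&& x \in A, y \in A & e x y]].

End Graph.

Section Codes.

Variables (F : finFieldType) (n k : nat).

(* The vertices of the Grassmann graph are the k-dimensional subspaces; all
   other subspaces are isolated points of this relation. *)
Definition grassmann_adj : rel {vspace 'rV[F]_n} :=
  [rel X Y | [&& \dim X == k, \dim Y == k & (\dim (X :&: Y)).+1 == k]].

Definition coord_hyperplane (i : 'I_n) : {set 'rV[F]_n} :=
  [set x : 'rV[F]_n | x 0 i == 0].

Definition nondeg_codes : {set {vspace 'rV[F]_n}} :=
  [set U : {vspace 'rV[F]_n} | (\dim U == k)
     && [forall i, ~~ (U \subset coord_hyperplane i)]].

Definition grassmann_dist : {vspace 'rV[F]_n} -> {vspace 'rV[F]_n} -> nat :=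
  graph_dist grassmann_adj.

Definition code_dist : {vspace 'rV[F]_n} -> {vspace 'rV[F]_n} -> nat :=
  graph_dist (induced grassmann_adj nondeg_codes).

End Codes.

(* Main.v *)
(** A step of a geodesic from X towards Y replaces X by Z = H + <y>, where H is
    a hyperplane of X containing the intersection of X and Y, and y is in Y but
    not in X.  Such a Z is degenerate only if y_i = 0 for some i with H inside
    C_i.  When dim (X :&: Y) <= k - 2, let H range over a pencil of q + 1
    hyperplanes of X through a common (k-2)-dimensional W containing X :&: Y.
    Each C_i contains at most one of them, as it does not contain X.  Since Y is
    not a union of q proper subspaces, failure for every H in the pencil would
    yield (q+1)^2 coordinates vanishing on W, whence
    n >= (q+1)^2 + dim W = (q+1)^2 + k - 2. *)
Require Import Defs.
From HB Require Import structures.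
From mathcomp Require Import all_boot all_order all_algebra.
From mathcomp Require Import finfield zify.

Set Implicit Arguments.
Unset Strict Implicit.
Unset Printing Implicit Defensive.

Import GRing.Theory.

(** * Walks and distance in a finite graph *)

Section GraphDist.

Variables (T : finType) (e : rel T).

Lemma walk_of_lengthP (x y : T) (m : nat) :
  reflect (exists p, [/\ size p = m, path e x p & last x p = y])
          (walk_of_length e x y m).
Proof.
apply: (iffP existsP) => [[p /andP[ep /eqP lp]]|[p [sp ep lp]]].
  by exists p; rewrite size_tuple.
by move/eqP: sp => sp; exists (Tuple sp); rewrite /= ep lp eqxx.
Qed.

Lemma graph_dist_le (x y : T) (m : nat) :
  walk_of_length e x y m -> graph_dist e x y <= m.
Proof.
move=> w; rewrite /graph_dist; case: (ltnP m #|T|) => [mT|Tm].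
  rewrite leqNgt; apply/negP => /(before_find 0).
  by rewrite nth_iota // add0n w.
(* The search stops at [#|T|] at the latest, so longer walks give the bound trivially. *)
by apply: leq_trans Tm; rewrite -[leqRHS](size_iota 0); apply: find_size.
Qed.

Lemma graph_dist_le_card (x y : T) : graph_dist e x y <= #|T|.
Proof. by rewrite -[leqRHS](size_iota 0); apply: find_size. Qed.

Lemma graph_dist_walk (x y : T) :
  graph_dist e x y < #|T| -> walk_of_length e x y (graph_dist e x y).
Proof.
move=> dT; have hasw : has (walk_of_length e x y) (iota 0 #|T|).
  by rewrite has_find size_iota.
by have := nth_find 0 hasw; rewrite nth_iota.
Qed.

End GraphDist.

Lemma graph_dist_mono (T : finType) (e e' : rel T) (x y : T) :
  subrel e e' -> graph_dist e' x y <= graph_dist e x y.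
Proof.
move=> ee'; apply: sub_find => m /walk_of_lengthP[p [sp ep lp]].
by apply/walk_of_lengthP; exists p; split=> //; apply: sub_path ep.
Qed.

(** * Dimension counts for subspaces *)

Section Subspaces.

Variables (K : fieldType) (vT : vectType K).
Implicit Types (U S X Y Z : {vspace vT}).
Local Open Scope vspace_scope.

Lemma dim_addv_line U (v : vT) : v \notin U -> \dim (U + <[v]>) = (\dim U).+1.
Proof.
move=> vU; have v0 : (v != 0)%R by apply: contraNneq vU => ->; apply: mem0v.
have /eqP cap0 : U :&: <[v]> == 0.
  rewrite -subv0; apply/subvP => w /memv_capP[wU /vlineP[c wc]].
  rewrite memv0; apply: contraNT vU => w0.
  have c0 : (c != 0)%R by apply: contraNneq w0 => c0; rewrite wc c0 scale0r.
  by rewrite -(scalerK c0 v) memvZ // -wc.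
by rewrite dimv_disjoint_sum // dim_vline v0 addn1.
Qed.

Lemma dim_lt_ex_notin U X :
  (\dim U < \dim X)%N -> exists2 v, v \in X & v \notin U.
Proof.
move=> dUX; apply/subvPn; apply: contraL dUX => XU.
by rewrite -leqNgt dimvS.
Qed.

Lemma ex_subspace_between S X j :
  S <= X -> (\dim S <= j <= \dim X)%N ->
  exists U, [/\ S <= U, U <= X & \dim U = j].
Proof.
move=> SX; elim: j => [|j IHj] /andP[Sj jX].
  by exists S; split=> //; lia.
have [Sj'|Sj'] := leqP (\dim S) j; last by exists S; split=> //; lia.
have [|U [SU UX dU]] := IHj; first by rewrite Sj' ltnW.
have [|v vX vU] := @dim_lt_ex_notin U X; first by rewrite dU.
exists (U + <[v]>); split; first exact: subv_trans SU (addvSl _ _).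
  by rewrite subv_add UX -memvE.
by rewrite dim_addv_line // dU.
Qed.

(** Apply the dimension formula inside [Z]: [X :&: Z] and [Z :&: Y] both lie in [Z] and meet within
    [X :&: Y]. Hence a Grassmann step gains at most one dimension of intersection with [Y]. *)
Lemma dim_cap_adj X Y Z : (\dim Z <= (\dim (X :&: Z)).+1)%N ->
  (\dim (Z :&: Y) <= (\dim (X :&: Y)).+1)%N.
Proof.
move=> XZ; have := dimv_sum_cap (X :&: Z) (Z :&: Y).
have /dimvS : X :&: Z + Z :&: Y <= Z by rewrite subv_add capvSr capvSl.
have /dimvS : (X :&: Z) :&: (Z :&: Y) <= X :&: Y.
  by apply: capvS; [apply: capvSl | apply: capvSr].
lia.
Qed.

End Subspaces.

(** * Vanishing coordinates, geodesic steps and walks of codes *)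

Section Codes.

Variables (F : finFieldType) (n : nat).
Implicit Types (W X Y Z : {vspace 'rV[F]_n}).

Lemma sub_coord_hyperplaneP X i :
  reflect (forall x, x \in X -> x 0%R i = 0%R)
          (X \subset coord_hyperplane F i).
Proof.
apply: (iffP subsetP) => sX x /sX; first by rewrite inE => /eqP.
by rewrite inE => ->.
Qed.

(* A subspace W embeds into the coordinates on which it does not vanish. *)
Lemma card_vanishing_coords W :
  #|[set i | W \subset coord_hyperplane F i]| + \dim W <= n.
Proof.
set I := [set i | _].
have /dimvS WI : (W <= <<[seq delta_mx 0%R i | i in ~: I]>>)%VS.
  apply/subvP => x xW; rewrite [x]row_sum_delta; apply: memv_suml => i _.
  case: (boolP (i \in I)) => [|iI].
    by rewrite inE => /sub_coord_hyperplaneP -> //; rewrite scale0r mem0v.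
  by apply/memvZ/memv_span/image_f; rewrite inE.
have := leq_trans WI (dim_span _); rewrite size_image.
by have := cardsC I; rewrite card_ord; lia.
Qed.

(* Discarding 0, each proper subspace [Y :&: C_i] has at most
   [q ^ (k - 1) - 1] vectors, and [q * (q ^ (k - 1) - 1) < q ^ k - 1]. *)
Lemma ex_nonvanishing_vector Y (J : {set 'I_n}) :
  0 < \dim Y -> #|J| <= #|F| ->
  (forall i, i \in J -> ~~ (Y \subset coord_hyperplane F i)) ->
  exists2 y, y \in Y & forall i, i \in J -> y 0%R i != 0%R.
Proof.
move=> dY cJ nJ; set H := fun i => (Y :&: lker (linfun (col i)))%VS.
have memH i y : (y \in H i) = (y \in Y) && (y 0%R i == 0%R).
  rewrite memv_cap memv_ker lfunE /=; congr (_ && _).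
  apply/eqP/eqP => [/matrixP/(_ 0%R 0%R)|y0]; first by rewrite !mxE.
  by apply/matrixP => a b; rewrite !mxE ord1.
have cH i : i \in J -> #|H i| <= #|F| ^ (\dim Y).-1.
  move=> iJ; rewrite card_vspace leq_exp2l ?finNzRing_gt1 // -ltnS (prednK dY).
  have HY : (H i <= Y)%VS by apply: capvSl.
  rewrite (ltn_leqif (dimv_leqif_sup HY)).
  apply: contra (nJ i iJ) => YH; apply/sub_coord_hyperplaneP => y yY.
  by have := subvP YH y yY; rewrite memH => /andP[_ /eqP].
case: (boolP [exists y, (y \in Y) && [forall i in J, y 0%R i != 0%R]]).
  by case/existsP => y /andP[yY /forall_inP yJ]; exists y.
move=> noY; exfalso.
have cover : [set y in Y | y != 0%R] \subset
             \bigcup_(i in J) [set y in H i | y != 0%R].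
  apply/subsetP => y; rewrite inE => /andP[yY y0].
  move: noY; rewrite negb_exists => /forallP/(_ y).
  rewrite yY negb_forall => /existsP[i]; rewrite negb_imply negbK.
  case/andP=> iJ yi; apply/bigcupP; exists i => //.
  by rewrite inE memH yY yi.
have card0 Z : #|[set y in Z | y != 0%R]|.+1 = #|Z|.
  rewrite (cardD1 0%R Z) mem0v cardsE add1n; congr _.+1.
  by apply: eq_card => y; rewrite !inE andbC.
have qpos : 0 < #|F| ^ (\dim Y).-1.
  by rewrite expn_gt0 (ltnW (finNzRing_gt1 _)).
have cU : #|\bigcup_(i in J) [set y in H i | y != 0%R]|
          <= #|J| * (#|F| ^ (\dim Y).-1).-1.
  rewrite -sum_nat_const.
  elim/big_rec2: _ => [|i u A iJ cA]; first by rewrite cards0.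
  rewrite (leq_trans (leq_card_setU _ _)) // leq_add //.
  by rewrite -ltnS card0 prednK ?qpos // cH.
have := leq_trans (subset_leq_card cover) cU.
have := card0 Y; rewrite card_vspace -{1}(prednK dY) expnS.
move: (finNzRing_gt1 F) cJ qpos.
move: #|J| #|F| (_ ^ _) #|[set y in Y | _]| => a q b c; nia.
Qed.

Lemma geodesic_step k X Y :
  n < (#|F| + 1) ^ 2 + k - 2 ->
  X \in nondeg_codes F n k -> Y \in nondeg_codes F n k ->
  \dim (X :&: Y) + 2 <= k ->
  exists Z, [/\ Z \in nondeg_codes F n k, grassmann_adj k X Z
              & \dim (X :&: Y) < \dim (Z :&: Y)].
Proof.
move=> hn; rewrite !inE => /andP[/eqP dX /forallP nX]
  /andP[/eqP dY /forallP nY].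
move=> dXY; have k2 : (k - 2).+2 = k.
  by rewrite -addn2 subnK // (leq_trans (leq_addl _ _) dXY).
have [|W [SW WX dW]] :=
    @ex_subspace_between _ _ (X :&: Y)%VS X (k - 2) (capvSl _ _).
  by lia.
have [|u uX uW] := @dim_lt_ex_notin _ _ W X; first by lia.
have dWu := dim_addv_line uW.
have [|v vX vWu] := @dim_lt_ex_notin _ _ (W + <[u]>)%VS X; first by lia.
have eX : X = (W + <[u]> + <[v]>)%VS.
  apply/esym/eqP; rewrite eqEdim dim_addv_line // !subv_add WX -!memvE uX vX /=.
  by lia.
have vW : v \notin W by apply: contra vWu => /(subvP (addvSl _ _)).
(* The pencil of hyperplanes of X through W, indexed by the projective line. *)
pose h (j : option F) := if j is Some c then (u + c *: v)%R else v.
have hX j : h j \in X by case: j => [c|] //=; rewrite memvD // memvZ.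
have hW j : h j \notin W.
  case: j => [c|] //=; have [->|c0] := eqVneq c 0%R.
    by rewrite scale0r addr0.
  apply: contra vWu => hW; rewrite -(scalerK c0 v) memvZ //.
  have -> : (c *: v = (u + c *: v) - u)%R by rewrite addrC addKr.
  by rewrite memv_add // memvN memv_line.
pose I := [set i | W \subset coord_hyperplane F i].
(* For [i] in [I], the i-th coordinate induces a nonzero functional on the plane X/W, since [X] is
   not inside C_i. Its kernel is a single point of the pencil, and [f i] is the index of that
   point. *)
pose f i : option F := if v 0%R i == 0%R then None
                       else Some (- u 0 i / v 0 i)%R.
have hf i j : i \in I -> h j 0%R i = 0%R -> f i = j.
  rewrite inE /f => /sub_coord_hyperplaneP WI.
  have uv : (u 0 i != 0)%R || (v 0 i != 0)%R.
    rewrite -negb_and; apply: contra (nX i) => /andP[/eqP u0 /eqP v0].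
    apply/sub_coord_hyperplaneP => x; rewrite eX.
    case/memv_addP=> _ /memv_addP[w /WI w0 [_ /vlineP[a ->] ->]].
    by case=> _ /vlineP[b ->] ->; rewrite !mxE w0 u0 v0 !mulr0 !addr0.
  case: j => [c|/= ->]; last by rewrite eqxx.
  rewrite !mxE; case: (v 0 i =P 0)%R uv => [->|/eqP v0 _].
    by rewrite orbF mulr0 addr0 => /eqP.
  by move/eqP; rewrite addr_eq0 => /eqP ->; rewrite opprK mulfK.
(* Pigeonhole: [f] sorts [I] into q + 1 fibres, and not all of them can have more than q
   elements. *)
have [j cj] : exists j, #|[set i in I | f i == j]| <= #|F|.
  apply/existsP; apply: contraTT hn; rewrite negb_exists => /forallP big.
  have : \sum_(j : option F) #|F|.+1 <= #|I|.
    rewrite -sum1_card (partition_big f xpredT) //=.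
    apply: leq_sum => j _; have := big j; rewrite -ltnNge -sum1_card.
    move/leq_trans; apply; rewrite leq_eqVlt; apply/orP; left; apply/eqP.
    by apply: eq_bigl => i; rewrite inE.
  rewrite sum_nat_const card_option.
  have := card_vanishing_coords W; rewrite dW -/I -leqNgt.
  rewrite addn1 -mulnn; move: (_ * _) => N; lia.
set J := [set i in I | f i == j] in cj.
(* If [J] is nonempty, being nonzero at some [i] in [J] already keeps [y] out of [X], because
   [X :&: Y] lies in [W] and thus in C_i. If [J] is empty, any vector of [Y] outside [X] will do. *)
have [y yY [yX yJ]] : exists2 y, y \in Y &
    y \notin X /\ forall i, i \in J -> y 0%R i != 0%R.
  have [J0|[i iJ]] := set_0Vmem J.
    have [|y yY yXY] := @dim_lt_ex_notin _ _ (X :&: Y)%VS Y.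
      by rewrite dY (leq_trans _ dXY) // addn2.
    exists y => //; split; last by move=> i; rewrite J0 inE.
    by apply: contra yXY => yX; rewrite memv_cap yX yY.
  have [||y yY yJ] := @ex_nonvanishing_vector Y J _ cj.
      by rewrite dY -k2.
    by move=> i' _; apply: nY.
  exists y => //; split=> //; apply: contra (yJ i iJ) => yX; apply/eqP.
  move: iJ; rewrite !inE => /andP[/sub_coord_hyperplaneP WI _]; apply: WI.
  by apply: (subvP SW); rewrite memv_cap yX yY.
pose H := (W + <[h j]>)%VS; pose Z := (H + <[y]>)%VS.
have HX : (H <= X)%VS by rewrite subv_add WX -memvE hX.
have yH : y \notin H by apply: contra yX; apply: (subvP HX).
have dH : (\dim H).+1 = k by rewrite dim_addv_line // dW k2.
have dZ : \dim Z = k by rewrite dim_addv_line.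
have yZ : y \in Z by apply: (subvP (addvSr _ _)); apply: memv_line.
exists Z; split.
(* A coordinate vanishing on [Z] vanishes on [W] and at [h j], so it belongs to [J], where [y] is
   nonzero. *)
- rewrite inE dZ eqxx /=; apply/forallP => i; apply/negP.
  move=> /sub_coord_hyperplaneP Zi.
  have iI : i \in I.
    rewrite inE; apply/sub_coord_hyperplaneP => w wW; apply: Zi.
    by do 2 apply: (subvP (addvSl _ _)).
  have hi : h j 0%R i = 0%R.
    apply: Zi; apply: (subvP (addvSl _ _)); apply: (subvP (addvSr _ _)).
    exact: memv_line.
  have /yJ : i \in J by rewrite inE iI (hf i j) ?eqxx.
  by rewrite Zi ?eqxx.
(* [X :&: Z] contains [H] and is proper in [Z], so its dimension is k - 1. *)
- have ltZ : \dim (X :&: Z) < \dim Z.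
    rewrite (ltn_leqif (dimv_leqif_sup (capvSr X Z))).
    by apply: contra yX => /subvP/(_ y yZ); rewrite memv_cap => /andP[].
  rewrite dZ in ltZ.
  rewrite /grassmann_adj /= dX dZ eqxx /= eqn_leq ltZ -{1}dH ltnS.
  by rewrite dimvS // subv_cap HX addvSl.
- have yXY : y \notin (X :&: Y)%VS.
    by apply: contra yX; rewrite memv_cap => /andP[].
  rewrite -(dim_addv_line yXY) dimvS // subv_cap !subv_add capvSr -!memvE yZ yY.
  rewrite !andbT; apply: subv_trans SW _; apply: subv_trans (addvSl _ _).
  exact: addvSl.
Qed.

(** The dimension of the intersection with [Y] must climb to k, by at most one per step. *)
Lemma grassmann_walk_bound k X Y p :
  \dim Y = k -> path (@grassmann_adj F n k) X p -> last X p = Y ->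
  k - \dim (X :&: Y) <= size p.
Proof.
move=> dY; elim: p X => [|Z p IHp] X /=.
  by move=> _ ->; rewrite capvv dY subnn.
case/andP => /and3P[_ /eqP dZ /eqP dXZ] Zp lp.
have := IHp Z Zp lp; have := @dim_cap_adj _ _ X Y Z; lia.
Qed.

Lemma code_walk k X Y :
  n < (#|F| + 1) ^ 2 + k - 2 ->
  X \in nondeg_codes F n k -> Y \in nondeg_codes F n k ->
  walk_of_length (induced (@grassmann_adj F n k) (nondeg_codes F n k)) X Y
    (k - \dim (X :&: Y)).
Proof.
move=> hn cX cY; apply/walk_of_lengthP.
have [m] := ubnP (k - \dim (X :&: Y)); elim: m X cX => // m IHm X cX hm.
have dim_code U : U \in nondeg_codes F n k -> \dim U = k.
  by rewrite inE => /andP[/eqP].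
have [dX dY] := (dim_code X cX, dim_code Y cY).
have XYX := dimvS (capvSl X Y); rewrite dX in XYX.
have [far|near] := leqP (\dim (X :&: Y) + 2) k.
  have [Z [cZ aXZ dZY]] := geodesic_step hn cX cY far.
  (* With the strict increase [dZY], this makes the gain exactly one, so the walk has the exact
     length required. *)
  have dZY' : \dim (Z :&: Y) <= (\dim (X :&: Y)).+1.
    by apply: dim_cap_adj; case/and3P: aXZ => _ /eqP -> /eqP ->.
  have [|p [sp Zp lp]] := IHm Z cZ; first by lia.
  exists (Z :: p); split=> //; first by rewrite /= sp; lia.
  by apply/andP; split=> //; apply/and3P.
(* Now the intersection has dimension k or k - 1: the codes are equal or adjacent. *)
have [eXY|nXY] := eqVneq (\dim (X :&: Y)) k.
  exists [::]; rewrite eXY subnn; split=> //=.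
  have eX : (X :&: Y)%VS = X by apply/eqP; rewrite eqEdim capvSl eXY dX /=.
  have eY : (X :&: Y)%VS = Y by apply/eqP; rewrite eqEdim capvSr eXY dY /=.
  by rewrite -{1}eX eY.
have dXY : (\dim (X :&: Y)).+1 = k by lia.
exists [:: Y]; split=> //; first by rewrite -dXY subSnn.
apply/andP; split=> //; apply/and3P; split=> //; apply/and3P.
by rewrite dX dY dXY.
Qed.

End Codes.

Theorem theorem1 (F : finFieldType) (n k : nat)
  (hk : 1 < k) (hkn : k < n - 1)
  (hn : n < (#|F| + 1) ^ 2 + k - 2)
  (X Y : {vspace 'rV[F]_n})
  (hX : X \in nondeg_codes F n k) (hY : Y \in nondeg_codes F n k) :
  code_dist k X Y = grassmann_dist k X Y.
Proof.
apply/eqP; rewrite eqn_leq; apply/andP; split; last first.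
  by apply: graph_dist_mono => U V /and3P[].
(* If the Grassmann distance takes the unreachable value [#|T|], the bound is trivial; otherwise it
   is realised by a walk. *)
have [Tg|gT] := leqP #|{: {vspace 'rV[F]_n}}| (grassmann_dist k X Y).
  exact: leq_trans (graph_dist_le_card _ _ _) Tg.
apply: leq_trans (graph_dist_le (code_walk hn hX hY)) _.
have /walk_of_lengthP[p [sp Xp lp]] := graph_dist_walk gT.
rewrite /grassmann_dist -sp; apply: grassmann_walk_bound Xp lp.
by move: hY; rewrite inE => /andP[/eqP].
Qed.
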